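(* Let $q\ge4$ be an even integer and define $$h_\infty(t)=\pi^{-q}|\sin(\pi t)|^q\,G(q,t),\quad 0<t<1,$$ where $G(q,t)=\zeta(q,t)+\zeta(q,1-t)$ and $\zeta(s,t)=\sum_{k=0}^\infty\frac{1}{(t+k)^s}$ for $s>1$, $0<t<1$. Then $h_\infty''(1/2)>0$; moreover, $h_\infty'(t)<0$ for all $t\in(0,1/2)$. *)

(* Defs.v *)
From Stdlib Require Import Reals.
From Coquelicot Require Import Coquelicot.
Open Scope R_scope.

(* [Rpower] is the real power x^y = exp (y ln x) for x > 0, so this is the
   Hurwitz zeta function for real s > 1 and t > 0; other values are junk. *)
Definition hurwitz_zeta (s t : R) : R :=
  Series (fun k : nat => / Rpower (t + INR k) s).

Definition G (s t : R) : R := hurwitz_zeta s t + hurwitz_zeta s (1 - t).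

(* Meaningful for 0 < t < 1 only; derivatives at points of the open interval
   (0,1) depend only on the values there. *)
Definition h_infty (q : nat) (t : R) : R :=
  / PI ^ q * Rabs (sin (PI * t)) ^ q * G (INR q) t.

(* Main.v *)
Require Import Defs.
From Stdlib Require Import Reals Lra Lia.
From Coquelicot Require Import Coquelicot.
Open Scope R_scope.

(** With y_k = 1/(t+k), k in Z, differentiating (sin(pi t)/pi)^q G(q,t) shows
    that h' < 0 amounts to
      pi cot(pi t) * sum y_k^q < sum y_k^(q+1).
    Since sum y_k^2 = pi^2/sin^2(pi t) (Herglotz's trick), and by
    differentiation sum y_k^3 = pi^3 cos(pi t)/sin^3(pi t), this says that
    [y^(q-2)] and [y] are positively correlated under weights proportional to
    y_k^2. Write a_i = 1/(t+i) and -b_i = -1/(1-t+i) for the positive and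
    negative y's. For t < 1/2 and i < j one has a_i >= b_i >= a_j >= b_j,
    a_i + b_j >= b_i + a_j and a_i b_j >= b_i a_j, so in the symmetric double
    sum for the covariance each negative term (b,b or b_i,a_j) is dominated by
    a positive one (a,a or a_i,b_j).
    At t = 1/2, up to a positive factor, h'' is
    (q+1) zeta(q+2,1/2) - pi^2 zeta(q,1/2), and the bounds
    zeta(q+2,1/2) >= 2^(q+2) and zeta(q,1/2) <= 2^(q-2) zeta(2,1/2)
    = 2^(q-3) pi^2 reduce its positivity to pi^4 < 160. *)

(** * Covariance inequality for interlaced sequences *)

(** Induction on [p], writing [a ^ (p+1) - b ^ (p+1)] as [a (a ^ p - b ^ p) + b ^ p (a - b)], and
    likewise for [c], [d]: each summand for [(c, d)] is at most the one for [(a, b)]. *)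
Lemma pow_four_le (p : nat) (a b c d : R) :
  a >= b -> b >= c -> c >= d -> 0 <= d -> b + c <= a + d ->
  b ^ p + c ^ p <= a ^ p + d ^ p.
Proof.
intros ab bc cd d0 H.
induction p as [|p IH]; simpl; [lra|].
assert (bd : d ^ p <= b ^ p) by (apply pow_incr; lra).
assert (cd' : d ^ p <= c ^ p) by (apply pow_incr; lra).
assert (d0' : 0 <= d ^ p) by (apply pow_le; lra).
assert (H1 : c * (c ^ p - d ^ p) <= a * (a ^ p - b ^ p))
  by (apply Rmult_le_compat; lra).
assert (H2 : d ^ p * (c - d) <= b ^ p * (a - b))
  by (apply Rmult_le_compat; lra).
lra.
Qed.

(* The contribution of the blocks (a, -b) and (c, -d) to the covariance of
   [y ^ p] and [y] under weights [y ^ 2] when [p] is even, whence the signs. *)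
Definition cross (p : nat) (a b c d : R) : R :=
  (a ^ (p + 3) - b ^ (p + 3)) * (c ^ 2 + d ^ 2)
  + (c ^ (p + 3) - d ^ (p + 3)) * (a ^ 2 + b ^ 2)
  - (a ^ (p + 2) + b ^ (p + 2)) * (c ^ 3 - d ^ 3)
  - (c ^ (p + 2) + d ^ (p + 2)) * (a ^ 3 - b ^ 3).

(** The expansion consists of four products, one for each pair of points taken from different
    blocks. Factor by factor, the pair [(a, c)] dominates [(b, d)], which needs [pow_four_le], and
    [(a, d)] dominates [(b, c)], which needs the hypotheses on sums and products. *)
Lemma cross_ge0 (p : nat) (a b c d : R) :
  a >= b -> b >= c -> c >= d -> 0 <= d -> b + c <= a + d -> b * c <= a * d ->
  0 <= cross p a b c d.
Proof.
intros ab bc cd d0 Hs Hp.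
assert (H4 := pow_four_le p a b c d ab bc cd d0 Hs).
assert (ab' : b ^ p <= a ^ p) by (apply pow_incr; lra).
assert (bc' : c ^ p <= b ^ p) by (apply pow_incr; lra).
assert (cd' : d ^ p <= c ^ p) by (apply pow_incr; lra).
assert (d0' : 0 <= d ^ p) by (apply pow_le; lra).
assert (bd0 : 0 <= b * d) by (apply Rmult_le_pos; lra).
assert (bc0 : 0 <= b * c) by (apply Rmult_le_pos; lra).
assert (bdac : b * d <= a * c) by (apply Rmult_le_compat; lra).
assert (same : (b ^ p - d ^ p) * (b - d) * (b * d) ^ 2
            <= (a ^ p - c ^ p) * (a - c) * (a * c) ^ 2).
{ apply Rmult_le_compat; [apply Rmult_le_pos; lra | apply pow_le; lra | |].
  - apply Rmult_le_compat; lra.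
  - apply pow_incr; lra. }
assert (opp : (b ^ p - c ^ p) * (b + c) * (b * c) ^ 2
           <= (a ^ p - d ^ p) * (a + d) * (a * d) ^ 2).
{ apply Rmult_le_compat; [apply Rmult_le_pos; lra | apply pow_le; lra | |].
  - apply Rmult_le_compat; lra.
  - apply pow_incr; lra. }
replace (cross p a b c d) with
  ((a ^ p - c ^ p) * (a - c) * (a * c) ^ 2
   - (b ^ p - d ^ p) * (b - d) * (b * d) ^ 2
   + ((a ^ p - d ^ p) * (a + d) * (a * d) ^ 2
      - (b ^ p - c ^ p) * (b + c) * (b * c) ^ 2)); [lra|].
unfold cross; rewrite !pow_add; ring.
Qed.

Section Chebyshev.

Variables (p : nat) (a b : nat -> R).

Let A n N := sum_f_R0 (fun k => a k ^ n) N.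
Let B n N := sum_f_R0 (fun k => b k ^ n) N.

Hypothesis ab : forall i, 0 <= b i <= a i.
Hypothesis ba : forall i j, (i < j)%nat -> a j <= b i.
Hypothesis addab : forall i j, (i < j)%nat -> b i + a j <= a i + b j.
Hypothesis mulab : forall i j, (i < j)%nat -> b i * a j <= a i * b j.

(** [cross] is additive over the first block, so this is its sum over the blocks [0..N] against the
    later block [j]. *)
Lemma cross_sum_ge0 (j N : nat) : (N < j)%nat ->
  0 <= (A (p + 3) N - B (p + 3) N) * (a j ^ 2 + b j ^ 2)
       + (a j ^ (p + 3) - b j ^ (p + 3)) * (A 2 N + B 2 N)
       - (A (p + 2) N + B (p + 2) N) * (a j ^ 3 - b j ^ 3)
       - (a j ^ (p + 2) + b j ^ (p + 2)) * (A 3 N - B 3 N).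
Proof.
assert (C : forall i, (i < j)%nat -> 0 <= cross p (a i) (b i) (a j) (b j)).
{ intros i ij.
  pose proof (ab i); pose proof (ab j); pose proof (ba i j ij).
  apply cross_ge0; auto; lra. }
induction N as [|N IH]; intros Nj.
- exact (C 0%nat Nj).
- assert (H1 := C _ Nj); assert (H2 := IH ltac:(lia)).
  unfold cross in H1; unfold A, B in *; rewrite !tech5; lra.
Qed.

(** The contribution of a single block, that is, of the pair of points [x] and [-y]. *)
Lemma diag_ge0 (x y : R) : 0 <= y <= x ->
  0 <= (x ^ (p + 3) - y ^ (p + 3)) * (x ^ 2 + y ^ 2)
       - (x ^ (p + 2) + y ^ (p + 2)) * (x ^ 3 - y ^ 3).
Proof.
intros xy.
replace (_ - _) with ((x ^ p - y ^ p) * (x + y) * (x * y) ^ 2)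
  by (rewrite !pow_add; ring).
assert (y ^ p <= x ^ p) by (apply pow_incr; lra).
apply Rmult_le_pos; [apply Rmult_le_pos; lra|apply pow2_ge_0].
Qed.

(** A new block adds its cross terms with the earlier blocks and its own diagonal term, all
    nonnegative. The diagonal term of block 0 is kept on the left so that strictness survives the
    limit. *)
Lemma chebyshev_partial (N : nat) :
  (a 0%nat ^ p - b 0%nat ^ p) * (a 0%nat + b 0%nat) * (a 0%nat * b 0%nat) ^ 2
  <= (A (p + 3) N - B (p + 3) N) * (A 2 N + B 2 N)
     - (A (p + 2) N + B (p + 2) N) * (A 3 N - B 3 N).
Proof.
induction N as [|N IH].
- unfold A, B; simpl sum_f_R0; rewrite !pow_add; apply Req_le; ring.
- assert (H1 := cross_sum_ge0 (S N) N (Nat.lt_succ_diag_r N)).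
  assert (H2 := diag_ge0 _ _ (ab (S N))).
  unfold A, B in *; rewrite !tech5; lra.
Qed.

End Chebyshev.

(** * Hurwitz series with integer exponent: convergence and elementary bounds *)

Definition zeta_nat (n : nat) (t : R) : R :=
  Series (fun k => / (t + INR k) ^ n).

Lemma term_pos (n k : nat) (t : R) : 0 < t -> 0 < / (t + INR k) ^ n.
Proof.
intros t0; pose proof (pos_INR k); apply Rinv_0_lt_compat, pow_lt; lra.
Qed.

Lemma term_le (n m k : nat) (t : R) : 0 < t ->
  / (t + INR k) ^ (n + m) <= / t ^ m * / (t + INR k) ^ n.
Proof.
intros t0; pose proof (pos_INR k).
rewrite pow_add, Rinv_mult, Rmult_comm.
apply Rmult_le_compat_r; [left; now apply term_pos|].
apply Rinv_le_contravar; [now apply pow_lt|apply pow_incr; lra].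
Qed.

Lemma ex_series_zeta2 (t : R) : 0 < t ->
  ex_series (fun k => / (t + INR k) ^ 2).
Proof.
intros t0.
destruct (ex_finite_lim_seq_incr
  (sum_n (fun k => / (t + INR k) ^ 2)) (/ t ^ 2 + / t)) as [l Hl].
- intros n; rewrite sum_Sn; unfold plus; simpl AbelianMonoid.plus.
  pose proof (term_pos 2 (S n) t t0); simpl in *; lra.
- intros n; rewrite sum_n_Reals.
  (* Telescoping majorant: [/ (t + k + 1) ^ 2 <= / (t + k) - / (t + k + 1)]. *)
  apply Rle_trans with (/ t ^ 2 + / t - / (t + INR n)).
  + induction n as [|n IH].
    * simpl; rewrite Rplus_0_r; lra.
    * rewrite tech5, S_INR; pose proof (pos_INR n).
      assert (/ (t + (INR n + 1)) ^ 2 <= / (t + INR n) - / (t + (INR n + 1)));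
        [|lra].
      replace (/ (t + INR n) - / (t + (INR n + 1)))
        with (/ ((t + INR n) * (t + (INR n + 1)))) by (field; lra).
      apply Rinv_le_contravar; nra.
  + pose proof (term_pos 1 n t t0) as H; rewrite pow_1 in H; lra.
- exists l; exact Hl.
Qed.

Lemma ex_series_zeta (n : nat) (t : R) : 0 < t ->
  ex_series (fun k => / (t + INR k) ^ (2 + n)).
Proof.
intros t0.
apply (ex_series_le (K := R_AbsRing) (V := R_CompleteNormedModule))
  with (b := fun k => / t ^ n * / (t + INR k) ^ 2).
- intros k; unfold norm; simpl norm; unfold abs; simpl abs.
  rewrite Rabs_pos_eq; [now apply term_le|left; now apply term_pos].
- apply (ex_series_scal_l (K := R_AbsRing) (V := R_NormedModule) (/ t ^ n)).
  now apply ex_series_zeta2.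
Qed.

Lemma zeta_lim (n : nat) (t : R) : 0 < t ->
  is_lim_seq (sum_f_R0 (fun k => / (t + INR k) ^ (2 + n))) (zeta_nat (2 + n) t).
Proof.
intros t0.
apply is_lim_seq_ext with (sum_n (fun k => / (t + INR k) ^ (2 + n))).
- intros N; apply sum_n_Reals.
- apply Series_correct, ex_series_zeta, t0.
Qed.

Lemma zeta_shift (n : nat) (t : R) : 0 < t ->
  zeta_nat (2 + n) t = / t ^ (2 + n) + zeta_nat (2 + n) (t + 1).
Proof.
intros t0; unfold zeta_nat.
rewrite Series_incr_1 by now apply ex_series_zeta.
rewrite Rplus_0_r; f_equal.
apply Series_ext; intros k; rewrite S_INR; do 2 f_equal; lra.
Qed.

Lemma zeta_decr (n : nat) (s t : R) : 0 < s <= t ->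
  zeta_nat (2 + n) t <= zeta_nat (2 + n) s.
Proof.
intros st; apply Series_le; [|apply ex_series_zeta; lra].
intros k; split; [left; apply term_pos; lra|].
pose proof (pos_INR k).
apply Rinv_le_contravar; [apply pow_lt; lra|apply pow_incr; lra].
Qed.

Lemma zeta_pos (n : nat) (t : R) : 0 < t -> 0 <= zeta_nat (2 + n) t.
Proof.
intros t0; unfold zeta_nat.
rewrite <- (Rmult_0_l (Series (fun k => / (t + INR k) ^ (2 + n)))).
rewrite <- Series_scal_l; apply Series_le; [|now apply ex_series_zeta].
intros k; pose proof (term_pos (2 + n) k t t0); lra.
Qed.

Lemma zeta_ge_head (n : nat) (t : R) : 0 < t ->
  / t ^ (2 + n) <= zeta_nat (2 + n) t.
Proof.
intros t0; rewrite zeta_shift by easy.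
pose proof (zeta_pos n (t + 1)); lra.
Qed.

Lemma zeta_le_zeta2 (n : nat) (t : R) : 0 < t ->
  zeta_nat (2 + n) t <= / t ^ n * zeta_nat 2 t.
Proof.
intros t0; unfold zeta_nat.
rewrite <- Series_scal_l; apply Series_le.
- intros k; split; [left; now apply term_pos|now apply term_le].
- apply (ex_series_scal_l (K := R_AbsRing) (V := R_NormedModule) (/ t ^ n)).
  now apply ex_series_zeta2.
Qed.

(** * Differentiation of the Hurwitz series by convexity *)

Lemma bernoulli_nonneg (n : nat) (r : R) : 0 <= r ->
  1 + INR n * (r - 1) <= r ^ n.
Proof.
intros r0; induction n as [|n IH]; [simpl; lra|].
rewrite S_INR; simpl pow; pose proof (pos_INR n).
pose proof (Rmult_le_compat_l r _ _ r0 IH).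
pose proof (Rmult_le_pos (INR n) ((r - 1) ^ 2) H (pow2_ge_0 _)).
nra.
Qed.

(** Convexity of the inverse power: Bernoulli's inequality with exponent [n + 1] at [r = u / v],
    multiplied by [v / u ^ (n + 1)]. *)
Lemma inv_pow_tangent (n : nat) (u v : R) : 0 < u -> 0 < v ->
  / u ^ n - INR n * (v - u) * / u ^ (S n) <= / v ^ n.
Proof.
intros u0 v0.
assert (H := bernoulli_nonneg (S n) (u / v)
  ltac:(left; now apply Rdiv_lt_0_compat)).
unfold Rdiv in H at 2; rewrite Rpow_mult_distr, pow_inv in H.
assert (c0 : 0 < v * / u ^ S n)
  by (apply Rmult_lt_0_compat; [easy|now apply Rinv_0_lt_compat, pow_lt]).
apply (Rmult_le_compat_l (v * / u ^ S n)) in H; [|lra].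
assert (un : u ^ n <> 0) by (apply pow_nonzero; lra).
assert (vn : v ^ n <> 0) by (apply pow_nonzero; lra).
rewrite S_INR in H; simpl pow in *.
replace (v * / (u * u ^ n) * (1 + (INR n + 1) * (u / v - 1)))
  with (/ u ^ n - INR n * (v - u) * / (u * u ^ n)) in H by (field; lra).
replace (v * / (u * u ^ n) * (u * u ^ n * / (v * v ^ n)))
  with (/ v ^ n) in H by (field; lra).
exact H.
Qed.

Lemma zeta_tangent (n : nat) (s t : R) : 0 < s -> 0 < t ->
  zeta_nat (2 + n) t - INR (2 + n) * (s - t) * zeta_nat (3 + n) t
  <= zeta_nat (2 + n) s.
Proof.
intros s0 t0.
assert (Ht := zeta_lim n t t0); assert (Ht' := zeta_lim (S n) t t0).
assert (L := is_lim_seq_minus' _ _ _ _ Ht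
  (is_lim_seq_scal_l _ (INR (2 + n) * (s - t)) _ Ht')).
refine (is_lim_seq_le _ _ _ _ _ L (zeta_lim n s s0)).
intros N; cbn beta; rewrite scal_sum, <- minus_sum.
apply sum_Rle; intros k _; pose proof (pos_INR k).
pose proof (inv_pow_tangent (2 + n) (t + INR k) (s + INR k)) as H'.
replace (s + INR k - (t + INR k)) with (s - t) in H' by ring.
rewrite Rmult_comm.
apply H'; lra.
Qed.

(** The tangent at [t] makes the remainder nonnegative. The tangent at [s] bounds it by
    [(2 + n) (s - t)] times the decrease of [zeta_nat (3 + n)] from [t] to [s], and the tangents of
    that function bound the decrease in turn. Monotonicity replaces the slopes by the value at
    [t / 2]. *)
Lemma zeta_remainder (n : nat) (s t : R) : 0 < t -> t / 2 <= s ->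
  Rabs (zeta_nat (2 + n) s - zeta_nat (2 + n) t
        + INR (2 + n) * (s - t) * zeta_nat (3 + n) t)
  <= INR (2 + n) * INR (3 + n) * zeta_nat (4 + n) (t / 2) * (s - t) ^ 2.
Proof.
intros t0 s0.
assert (H1 := zeta_tangent n s t ltac:(lra) t0).
assert (H2 := zeta_tangent n t s t0 ltac:(lra)).
assert (H3 := zeta_tangent (S n) s t ltac:(lra) t0).
assert (H4 := zeta_tangent (S n) t s t0 ltac:(lra)).
assert (H5 := zeta_decr (2 + n) (t / 2) t ltac:(lra)).
assert (H6 := zeta_decr (2 + n) (t / 2) s ltac:(lra)).
change (2 + S n)%nat with (3 + n)%nat in *.
change (3 + S n)%nat with (4 + n)%nat in *.
change (2 + (2 + n))%nat with (4 + n)%nat in *.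
assert (N2 := pos_INR (2 + n)); assert (N3 := pos_INR (3 + n)).
set (M := zeta_nat (4 + n) (t / 2)) in *.
assert (L : (s - t) * (zeta_nat (3 + n) t - zeta_nat (3 + n) s)
            <= INR (3 + n) * M * (s - t) ^ 2).
{ destruct (Rle_lt_dec t s) as [ts|st].
  - assert (0 <= (INR (3 + n) * (s - t)) * (M - zeta_nat (4 + n) t))
      by (repeat apply Rmult_le_pos; lra).
    assert (E : zeta_nat (3 + n) t - zeta_nat (3 + n) s
       <= INR (3 + n) * (s - t) * M) by lra.
    apply (Rmult_le_compat_l (s - t)) in E; lra.
  - assert (0 <= (INR (3 + n) * (t - s)) * (M - zeta_nat (4 + n) s))
      by (repeat apply Rmult_le_pos; lra).
    assert (E : zeta_nat (3 + n) s - zeta_nat (3 + n) t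
       <= INR (3 + n) * (t - s) * M) by lra.
    apply (Rmult_le_compat_l (t - s)) in E; lra. }
apply (Rmult_le_compat_l (INR (2 + n))) in L; [|easy].
rewrite Rabs_pos_eq; lra.
Qed.

Lemma is_derive_quadratic (f : R -> R) (x l C : R) (d : posreal) :
  (forall y, Rabs (y - x) < d ->
     Rabs (f y - f x - (y - x) * l) <= C * (y - x) ^ 2) ->
  is_derive f x l.
Proof.
intros H; apply is_derive_Reals; intros e e0.
assert (C0 : 0 < Rabs C + 1) by (pose proof (Rabs_pos C); lra).
assert (r0 : 0 < Rmin d (e / (Rabs C + 1)))
  by (apply Rmin_pos; [apply cond_pos|now apply Rdiv_lt_0_compat]).
exists (mkposreal _ r0); intros h h0 hr; simpl in hr.
assert (hd := Rlt_le_trans _ _ _ hr (Rmin_l _ _)).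
assert (he := Rlt_le_trans _ _ _ hr (Rmin_r _ _)).
assert (H' := H (x + h)).
replace (x + h - x) with h in H' by ring.
specialize (H' hd).
assert (ha : 0 < Rabs h) by now apply Rabs_pos_lt.
replace ((f (x + h) - f x) / h - l) with ((f (x + h) - f x - h * l) / h)
  by (field; easy).
rewrite Rabs_div by easy.
apply Rlt_div_l; [easy|].
apply Rle_lt_trans with (1 := H').
rewrite <- (pow2_abs h).
apply Rlt_div_r in he; [|easy].
pose proof (Rle_abs C).
assert (C * Rabs h < e) by nra.
nra.
Qed.

Lemma is_derive_zeta (n : nat) (t : R) : 0 < t ->
  is_derive (zeta_nat (2 + n)) t (- INR (2 + n) * zeta_nat (3 + n) t).
Proof.
intros t0; assert (h0 : 0 < t / 2) by lra.
apply (is_derive_quadratic _ _ _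
  (INR (2 + n) * INR (3 + n) * zeta_nat (4 + n) (t / 2)) (mkposreal _ h0)).
intros s Hs; simpl in Hs; apply Rabs_def2 in Hs.
assert (H := zeta_remainder n s t t0 ltac:(lra)).
replace (_ - _ - _) with (zeta_nat (2 + n) s - zeta_nat (2 + n) t
        + INR (2 + n) * (s - t) * zeta_nat (3 + n) t); [exact H|ring].
Qed.

(** * Reflection formulas for exponents 2 and 3 *)

(** Splits the series at [t] into its even and odd indices. *)
Lemma zeta2_duplication (t : R) : 0 < t ->
  zeta_nat 2 (t / 2) + zeta_nat 2 ((t + 1) / 2) = 4 * zeta_nat 2 t.
Proof.
intros t0.
assert (L1 := is_lim_seq_plus' _ _ _ _ (zeta_lim 0 (t / 2) ltac:(lra))
                (zeta_lim 0 ((t + 1) / 2) ltac:(lra))).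
assert (L2 := is_lim_seq_scal_l _ 4 _ (zeta_lim 0 t t0)).
(* Indices [0..N] of both series on the left match indices [0..2N+1] on the right. *)
apply is_lim_seq_subseq with (phi := fun N => S (2 * N)) in L2;
  [|apply eventually_subseq; intros N; lia].
apply is_lim_seq_unique in L1; apply is_lim_seq_unique in L2.
enough (E : Finite (zeta_nat 2 (t / 2) + zeta_nat 2 ((t + 1) / 2))
            = Finite (4 * zeta_nat 2 t)) by now injection E.
etransitivity; [symmetry; exact L1|etransitivity; [|exact L2]].
apply Lim_seq_ext; intros N; change (2 + 0)%nat with 2%nat.
induction N as [|N IH].
- simpl; field; lra.
- replace (S (2 * S N)) with (S (S (S (2 * N)))) by lia.
  rewrite !tech5, !S_INR, mult_INR; pose proof (pos_INR N).
  rewrite !tech5, !Rmult_plus_distr_l, S_INR, mult_INR in *.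
  simpl INR in *.
  match goal with |- ?a + ?b + (?c + ?d) = _ =>
    replace (a + b + (c + d)) with ((a + c) + (b + d)) by ring end.
  rewrite IH; field; lra.
Qed.

Lemma sin_PI_pos (t : R) : 0 < t < 1 -> 0 < sin (PI * t).
Proof.
intros t01; pose proof PI_RGT_0; apply sin_gt_0; nra.
Qed.

(** Shows that the double poles at 0 cancel in the Herglotz defect. The numerator
    [x ^ 2 - sin x ^ 2] is at most [x ^ 4 / 3] and the denominator at least [x ^ 4 / 9]. *)
Lemma inv_sin2_bound (x : R) : 0 < x <= PI / 2 ->
  0 <= / sin x ^ 2 - / x ^ 2 <= 3.
Proof.
intros x0; pose proof PI_4.
assert (sx : sin x <= x) by (left; apply sin_lt_x; lra).
assert (lb := sin_bound x 0 ltac:(lra) ltac:(lra)); destruct lb as [lb _].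
unfold sin_approx, sin_term in lb; simpl in lb.
assert (lb' : x - x ^ 3 / 6 <= sin x) by lra.
(* [PI_4] gives [x <= 2], hence [x ^ 3 / 6 <= 2 x / 3]. *)
assert (x3 : x / 3 <= sin x) by nra.
split.
- apply Rge_le, Rge_minus, Rle_ge, Rinv_le_contravar;
    [apply pow_lt; lra|apply pow_incr; lra].
- replace (/ sin x ^ 2 - / x ^ 2)
    with ((x - sin x) * (x + sin x) / (x ^ 2 * sin x ^ 2)) by (field; lra).
  apply Rle_div_l; [apply Rmult_lt_0_compat; apply pow_lt; lra|].
  assert ((x - sin x) * (x + sin x) <= x ^ 3 / 6 * (2 * x))
    by (apply Rmult_le_compat; lra).
  assert ((x / 3) ^ 2 <= sin x ^ 2) by (apply pow_incr; lra).
  assert (x ^ 2 * (x / 3) ^ 2 <= x ^ 2 * sin x ^ 2)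
    by (apply Rmult_le_compat_l; [apply pow2_ge_0|easy]).
  lra.
Qed.

Lemma sin_PI_reflect (t : R) : sin (PI * (1 - t)) = sin (PI * t).
Proof.
replace (PI * (1 - t)) with (PI - PI * t) by ring; apply sin_PI_x.
Qed.

(* Herglotz's trick: the defect is bounded on (0,1) and satisfies
   [defect (t/2) + defect ((t+1)/2) = 4 * defect t]. *)
Lemma zeta2_reflection (t : R) : 0 < t < 1 ->
  zeta_nat 2 t + zeta_nat 2 (1 - t) = PI ^ 2 / sin (PI * t) ^ 2.
Proof.
set (g := fun t => PI ^ 2 / sin (PI * t) ^ 2
                   - (zeta_nat 2 t + zeta_nat 2 (1 - t))).
assert (P0 := PI_RGT_0).
assert (func : forall t, 0 < t < 1 -> g (t / 2) + g ((t + 1) / 2) = 4 * g t).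
{ intros u u01; unfold g.
  assert (D1 := zeta2_duplication u ltac:(lra)).
  assert (D2 := zeta2_duplication (1 - u) ltac:(lra)).
  replace ((1 - u + 1) / 2) with (1 - u / 2) in D2 by field.
  replace ((1 - u) / 2) with (1 - (u + 1) / 2) in D2 by field.
  assert (s1 := sin_PI_pos (u / 2) ltac:(lra)).
  assert (s2 := sin_PI_pos ((u + 1) / 2) ltac:(lra)).
  replace (PI * ((u + 1) / 2)) with (PI * (u / 2) + PI / 2) in * by field.
  rewrite sin_plus, cos_PI2, sin_PI2, Rmult_0_r, Rmult_1_r, Rplus_0_l in *.
  replace (PI * u) with (2 * (PI * (u / 2))) by field.
  rewrite sin_2a.
  assert (cs := sin2_cos2 (PI * (u / 2))); unfold Rsqr in cs.
  set (s := sin _) in *; set (c := cos _) in *.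
  (* The sine side obeys the same duplication formula as the zeta side. *)
  assert (E : PI ^ 2 / s ^ 2 + PI ^ 2 / c ^ 2 = 4 * (PI ^ 2 / (2 * s * c) ^ 2)).
  { transitivity (PI ^ 2 * (s * s + c * c) / (s ^ 2 * c ^ 2));
      [field; lra|rewrite cs; field; lra]. }
  lra. }
set (M := 3 * PI ^ 2 + zeta_nat 2 1 + zeta_nat 2 (1 / 2)).
assert (half : forall u, 0 < u <= 1 / 2 -> Rabs (g u) <= M).
{ intros u u0; unfold g, M.
  assert (B := inv_sin2_bound (PI * u) ltac:(nra)).
  (* Isolates the pole [/ u ^ 2], which cancels the first term of [zeta_nat 2 u]. *)
  replace (PI ^ 2 / sin (PI * u) ^ 2) with
    (PI ^ 2 * (/ sin (PI * u) ^ 2 - / (PI * u) ^ 2) + / u ^ 2)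
    by (field; pose proof (sin_PI_pos u); lra).
  rewrite (zeta_shift 0) by lra.
  assert (Z1 := zeta_decr 0 1 (u + 1) ltac:(lra)).
  assert (Z2 := zeta_decr 0 (1 / 2) (1 - u) ltac:(lra)).
  assert (Z3 := zeta_pos 0 (u + 1) ltac:(lra)).
  assert (Z4 := zeta_pos 0 (1 - u) ltac:(lra)).
  simpl Nat.add in *.
  assert (0 < PI ^ 2) by now apply pow_lt.
  set (y := / sin _ ^ 2 - _) in *.
  assert (0 <= PI ^ 2 * y) by (apply Rmult_le_pos; lra).
  assert (PI ^ 2 * y <= PI ^ 2 * 3) by (apply Rmult_le_compat_l; lra).
  apply Rabs_le; lra. }
assert (sym : forall u, g (1 - u) = g u).
{ intros u; unfold g; rewrite sin_PI_reflect.
  replace (1 - (1 - u)) with u by ring; lra. }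
(* The functional equation writes [g] as a quarter of a sum of two values, so every bound on the
   whole interval can be halved. *)
assert (bound : forall n u, 0 < u < 1 -> Rabs (g u) <= M * (/ 2) ^ n).
{ induction n as [|n IH]; intros u u01.
  - rewrite Rmult_1_r; destruct (Rle_lt_dec u (1 / 2)).
    + apply half; lra.
    + rewrite <- sym; apply half; lra.
  - assert (F := func u u01).
    assert (B1 := IH (u / 2) ltac:(lra)).
    assert (B2 := IH ((u + 1) / 2) ltac:(lra)).
    apply Rabs_le_between in B1; apply Rabs_le_between in B2.
    apply Rabs_le; simpl; lra. }
intros t01.
enough (E : g t = 0) by (unfold g in E; lra).
assert (L := is_lim_seq_scal_l _ M _
  (is_lim_seq_geom (/ 2) ltac:(rewrite Rabs_pos_eq; lra))).
assert (H := is_lim_seq_le _ _ _ _ (fun n => bound n t t01)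
  (is_lim_seq_const _) L).
simpl in H; rewrite Rmult_0_r in H.
pose proof (Rabs_pos (g t)).
destruct (Req_dec (g t) 0) as [|ne]; [easy|].
pose proof (Rabs_pos_lt _ ne); lra.
Qed.

Lemma locally_01 (P : R -> Prop) (t : R) : 0 < t < 1 ->
  (forall u, 0 < u < 1 -> P u) -> locally t P.
Proof.
intros t01 H.
assert (d0 : 0 < Rmin t (1 - t)) by (apply Rmin_pos; lra).
exists (mkposreal _ d0); intros u Hu; apply H.
unfold ball in Hu; simpl in Hu; unfold AbsRing_ball in Hu.
apply Rabs_def2 in Hu; simpl in Hu; unfold minus, plus, opp in Hu; simpl in Hu.
pose proof (Rmin_l t (1 - t)); pose proof (Rmin_r t (1 - t)); lra.
Qed.

Lemma is_derive_zeta_reflect (n : nat) (t : R) : t < 1 ->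
  is_derive (fun u => zeta_nat (2 + n) (1 - u)) t
    (INR (2 + n) * zeta_nat (3 + n) (1 - t)).
Proof.
intros t1.
assert (D : is_derive (fun u => 1 - u) t (-1)) by (auto_derive; [easy|ring]).
assert (C := is_derive_comp _ _ _ _ _ (is_derive_zeta n (1 - t) ltac:(lra)) D).
unfold scal in C; simpl scal in C; unfold mult in C; simpl mult in C.
replace (INR (2 + n) * zeta_nat (3 + n) (1 - t))
  with (-1 * (- INR (2 + n) * zeta_nat (3 + n) (1 - t))) by ring.
exact C.
Qed.

(** Derivative of [zeta2_reflection], divided by -2. *)
Lemma zeta3_reflection (t : R) : 0 < t < 1 ->
  zeta_nat 3 t - zeta_nat 3 (1 - t)
  = PI ^ 3 * cos (PI * t) / sin (PI * t) ^ 3.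
Proof.
intros t01; assert (s0 := sin_PI_pos t t01).
assert (D1 := is_derive_plus _ _ _ _ _ (is_derive_zeta 0 t ltac:(lra))
                (is_derive_zeta_reflect 0 t ltac:(lra))).
assert (D2 : is_derive (fun u => PI ^ 2 / sin (PI * u) ^ 2) t
               (-2 * (PI ^ 3 * cos (PI * t) / sin (PI * t) ^ 3))).
{ auto_derive.
  - apply Rgt_not_eq; repeat apply Rmult_lt_0_compat; lra.
  - field; lra. }
apply (is_derive_ext_loc _ _ _ _ (locally_01 _ t t01 zeta2_reflection)) in D1.
apply is_derive_unique in D1; apply is_derive_unique in D2.
assert (X := eq_trans (eq_sym D1) D2).
set (y := _ / _) in *; unfold plus in X; simpl in X; lra.
Qed.

(** * The two key inequalities between zeta values *)

(** Limit of [chebyshev_partial]. The inequality stays strict because the block 0 term is positive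
    and independent of [N]. *)
Lemma zeta_chebyshev (p : nat) (t : R) : (0 < p)%nat -> 0 < t < 1 / 2 ->
  (zeta_nat (2 + p) t + zeta_nat (2 + p) (1 - t))
    * (zeta_nat 3 t - zeta_nat 3 (1 - t))
  < (zeta_nat (3 + p) t - zeta_nat (3 + p) (1 - t))
    * (zeta_nat 2 t + zeta_nat 2 (1 - t)).
Proof.
intros p0 t0.
set (a := fun k => / (t + INR k)); set (b := fun k => / (1 - t + INR k)).
assert (ab : forall i, 0 <= b i <= a i).
{ intros i; unfold a, b; pose proof (pos_INR i); split.
  - left; apply Rinv_0_lt_compat; lra.
  - apply Rinv_le_contravar; lra. }
assert (ltI : forall i j, (i < j)%nat -> 0 <= INR i /\ INR i + 1 <= INR j).
{ intros i j ij; split; [apply pos_INR|].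
  rewrite <- S_INR; apply le_INR; lia. }
assert (ba : forall i j, (i < j)%nat -> a j <= b i).
{ intros i j ij; destruct (ltI i j ij); apply Rinv_le_contravar; lra. }
assert (addab : forall i j, (i < j)%nat -> b i + a j <= a i + b j).
{ intros i j ij; destruct (ltI i j ij); unfold a, b.
  (* The difference [a i - b i] has this form, which decreases in the index. *)
  assert ((1 - 2 * t) * / ((t + INR j) * (1 - t + INR j))
          <= (1 - 2 * t) * / ((t + INR i) * (1 - t + INR i))).
  { apply Rmult_le_compat_l; [lra|].
    apply Rinv_le_contravar; [apply Rmult_lt_0_compat; lra|].
    apply Rmult_le_compat; lra. }
  enough (/ (t + INR j) - / (1 - t + INR j) <= / (t + INR i) - / (1 - t + INR i))
    by lra.
  replace (/ (t + INR j) - / (1 - t + INR j))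
    with ((1 - 2 * t) * / ((t + INR j) * (1 - t + INR j))) by (field; lra).
  replace (/ (t + INR i) - / (1 - t + INR i))
    with ((1 - 2 * t) * / ((t + INR i) * (1 - t + INR i))) by (field; lra).
  easy. }
assert (mulab : forall i j, (i < j)%nat -> b i * a j <= a i * b j).
{ intros i j ij; destruct (ltI i j ij); unfold a, b; rewrite <- !Rinv_mult.
  apply Rinv_le_contravar; [apply Rmult_lt_0_compat; lra|].
  (* This is the difference of the two denominators. *)
  assert (0 <= (1 - 2 * t) * (INR j - INR i)) by (apply Rmult_le_pos; lra).
  lra. }
assert (a0 : 0 < b 0%nat < a 0%nat).
{ unfold a, b; simpl INR; split; [apply Rinv_0_lt_compat; lra|].
  apply Rinv_lt_contravar; [apply Rmult_lt_0_compat|]; lra. }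
assert (pos : 0 < (a 0%nat ^ p - b 0%nat ^ p) * (a 0%nat + b 0%nat)
                  * (a 0%nat * b 0%nat) ^ 2).
{ apply Rmult_lt_0_compat;
    [|now apply pow_lt, Rmult_lt_0_compat; lra].
  apply Rmult_lt_0_compat; [|lra].
  destruct p as [|p]; [lia|simpl].
  assert (b 0%nat ^ p <= a 0%nat ^ p) by (apply pow_incr; lra).
  assert (0 < b 0%nat ^ p) by (apply pow_lt; lra).
  nra. }
assert (La : forall n, is_lim_seq (sum_f_R0 (fun k => a k ^ (2 + n)))
                         (zeta_nat (2 + n) t)).
{ intros n; eapply is_lim_seq_ext; [|apply zeta_lim; lra].
  intros N; apply sum_eq; intros k _; symmetry; apply pow_inv. }
assert (Lb : forall n, is_lim_seq (sum_f_R0 (fun k => b k ^ (2 + n)))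
                         (zeta_nat (2 + n) (1 - t))).
{ intros n; eapply is_lim_seq_ext; [|apply zeta_lim; lra].
  intros N; apply sum_eq; intros k _; symmetry; apply pow_inv. }
assert (H := chebyshev_partial p a b ab ba addab mulab).
rewrite (Nat.add_comm p 2), (Nat.add_comm p 3) in H.
assert (L := is_lim_seq_minus' _ _ _ _
  (is_lim_seq_mult' _ _ _ _
    (is_lim_seq_minus' _ _ _ _ (La (S p)) (Lb (S p)))
    (is_lim_seq_plus' _ _ _ _ (La 0%nat) (Lb 0%nat)))
  (is_lim_seq_mult' _ _ _ _
    (is_lim_seq_plus' _ _ _ _ (La p) (Lb p))
    (is_lim_seq_minus' _ _ _ _ (La 1%nat) (Lb 1%nat)))).
assert (R := is_lim_seq_le _ _ _ _ H (is_lim_seq_const _) L).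
simpl in R; simpl; lra.
Qed.

Lemma PI_pow4_lt : PI ^ 4 < 160.
Proof.
assert (B := proj2 (PI_ineq 1)); pose proof PI_RGT_0.
unfold tg_alt, PI_tg in B; simpl in B.
(* Leibniz series: [PI / 4 <= 1 - 1/3 + 1/5 = 13/15]. *)
assert (P : PI <= 52 / 15) by lra.
assert (PI ^ 4 <= (52 / 15) ^ 4) by (apply pow_incr; lra).
lra.
Qed.

Lemma zeta_half_ratio (p : nat) : (2 <= p)%nat ->
  PI ^ 2 * zeta_nat (2 + p) (1 / 2)
  < INR (3 + p) * zeta_nat (4 + p) (1 / 2).
Proof.
intros p2.
assert (Z2 := zeta2_reflection (1 / 2) ltac:(lra)).
replace (1 - 1 / 2) with (1 / 2) in Z2 by field.
replace (PI * (1 / 2)) with (PI / 2) in Z2 by field.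
rewrite sin_PI2 in Z2.
assert (U := zeta_le_zeta2 p (1 / 2) ltac:(lra)).
assert (L := zeta_ge_head (2 + p) (1 / 2) ltac:(lra)).
assert (Hi : forall n, / (1 / 2) ^ n = 2 ^ n).
{ intros n; rewrite <- pow_inv; f_equal; field. }
rewrite Hi in U, L; change (2 + (2 + p))%nat with (4 + p)%nat in L.
replace (2 ^ (4 + p)) with (16 * 2 ^ p) in L by (simpl; ring).
assert (T : 0 < 2 ^ p) by (apply pow_lt; lra).
assert (I5 : 5 <= INR (3 + p)).
{ replace 5 with (INR 5) by (simpl; ring); apply le_INR; lia. }
assert (P4 := PI_pow4_lt); assert (P0 : 0 < PI ^ 2) by (apply pow_lt, PI_RGT_0).
apply Rle_lt_trans with (PI ^ 2 * (2 ^ p * zeta_nat 2 (1 / 2)));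
  [apply Rmult_le_compat_l; lra|].
(* By reflection at 1/2 the left side is [PI ^ 4 / 2 * 2 ^ p], and [5 * 16] is half of 160. *)
apply Rlt_le_trans with (5 * (16 * 2 ^ p)).
- replace (zeta_nat 2 (1 / 2)) with (PI ^ 2 / 2) by lra.
  replace (PI ^ 2 * (2 ^ p * (PI ^ 2 / 2))) with (PI ^ 4 / 2 * 2 ^ p) by field.
  nra.
- apply Rmult_le_compat; lra.
Qed.

(** * First and second derivatives of [h_infty] *)

(** For [0 < t < 1] and [n >= 2] these are the sums over all integers [k] of [|t + k| ^ (-n)],
    without and with the sign of [t + k]. Differentiation exchanges the two kinds. *)
Definition zeta_even (n : nat) (t : R) := zeta_nat n t + zeta_nat n (1 - t).
Definition zeta_odd (n : nat) (t : R) := zeta_nat n t - zeta_nat n (1 - t).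

Lemma is_derive_zeta_even (n : nat) (t : R) : 0 < t < 1 ->
  is_derive (zeta_even (2 + n)) t (- INR (2 + n) * zeta_odd (3 + n) t).
Proof.
intros t01.
assert (D := is_derive_plus _ _ _ _ _ (is_derive_zeta n t ltac:(lra))
               (is_derive_zeta_reflect n t ltac:(lra))).
enough (E : - INR (2 + n) * zeta_nat (3 + n) t
            + INR (2 + n) * zeta_nat (3 + n) (1 - t)
            = - INR (2 + n) * zeta_odd (3 + n) t) by (rewrite <- E; exact D).
unfold zeta_odd; ring.
Qed.

Lemma is_derive_zeta_odd (n : nat) (t : R) : 0 < t < 1 ->
  is_derive (zeta_odd (2 + n)) t (- INR (2 + n) * zeta_even (3 + n) t).
Proof.
intros t01.
assert (D := is_derive_minus _ _ _ _ _ (is_derive_zeta n t ltac:(lra))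
               (is_derive_zeta_reflect n t ltac:(lra))).
enough (E : - INR (2 + n) * zeta_nat (3 + n) t
            - INR (2 + n) * zeta_nat (3 + n) (1 - t)
            = - INR (2 + n) * zeta_even (3 + n) t) by (rewrite <- E; exact D).
unfold zeta_even; ring.
Qed.

Lemma h_infty_eq (q : nat) (t : R) : 0 < t < 1 ->
  h_infty q t = / PI ^ q * (sin (PI * t) ^ q * zeta_even q t).
Proof.
intros t01; unfold h_infty, G, zeta_even, hurwitz_zeta, zeta_nat.
rewrite Rabs_pos_eq by (left; now apply sin_PI_pos).
rewrite Rmult_assoc; do 3 f_equal; apply Series_ext; intros k;
  pose proof (pos_INR k); rewrite Rpower_pow; lra.
Qed.

(** Factored so that on (0,1), for [q >= 1], the sign is that of the last factor, which vanishes at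
    1/2. *)
Definition dh_infty (q : nat) (t : R) : R :=
  INR q / PI ^ q * sin (PI * t) ^ (q - 1)
  * (PI * cos (PI * t) * zeta_even q t - sin (PI * t) * zeta_odd (S q) t).

(** Serves both derivatives: [f] is first [zeta_even], then the last factor of [dh_infty]. *)
Lemma is_derive_sin_pow_mult (c : R) (q : nat) (f : R -> R) (t l : R) :
  is_derive f t l ->
  is_derive (fun u => c * sin (PI * u) ^ q * f u) t
    (c * (INR q * (PI * cos (PI * t)) * sin (PI * t) ^ pred q * f t
          + sin (PI * t) ^ q * l)).
Proof.
intros D; auto_derive; [now exists l|].
change (fun x => f x) with f; rewrite (is_derive_unique _ _ _ D); ring.
Qed.

Lemma is_derive_h_infty (p : nat) (t : R) : 0 < t < 1 ->
  is_derive (h_infty (2 + p)) t (dh_infty (2 + p) t).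
Proof.
intros t01.
apply is_derive_ext_loc with
  (fun u => / PI ^ (2 + p) * sin (PI * u) ^ (2 + p) * zeta_even (2 + p) u).
{ apply locally_01; [easy|]; intros u u01; symmetry.
  rewrite Rmult_assoc; now apply h_infty_eq. }
assert (D := is_derive_sin_pow_mult (/ PI ^ (2 + p)) (2 + p) _ _ _
               (is_derive_zeta_even p t t01)).
enough (E : dh_infty (2 + p) t = / PI ^ (2 + p)
  * (INR (2 + p) * (PI * cos (PI * t)) * sin (PI * t) ^ pred (2 + p)
     * zeta_even (2 + p) t
     + sin (PI * t) ^ (2 + p) * (- INR (2 + p) * zeta_odd (3 + p) t)))
  by (rewrite E; exact D).
unfold dh_infty; change (2 + p - 1)%nat with (S p).
change (pred (2 + p)) with (S p); change (S (2 + p)) with (3 + p)%nat.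
simpl pow; field.
split; [apply pow_nonzero|]; apply PI_neq0.
Qed.

Lemma dh_infty_neg (p : nat) (t : R) : (0 < p)%nat -> 0 < t < 1 / 2 ->
  dh_infty (2 + p) t < 0.
Proof.
intros p0 t0; unfold dh_infty; assert (P0 := PI_RGT_0).
assert (s0 := sin_PI_pos t ltac:(lra)).
assert (C := zeta_chebyshev p t p0 t0).
rewrite zeta2_reflection, zeta3_reflection in C by lra.
set (s := sin _) in *; set (c := cos _) in *.
change (zeta_nat (2 + p) t + _) with (zeta_even (2 + p) t) in C.
change (zeta_nat (3 + p) t - _) with (zeta_odd (3 + p) t) in C.
change (S (2 + p)) with (3 + p)%nat.
(* After the reflection formulas, this multiplier turns the two sides of [C] into the two terms of
   the last factor of [dh_infty]. *)
assert (K : 0 < s ^ 3 / PI ^ 2)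
  by (apply Rdiv_lt_0_compat; apply pow_lt; easy).
apply (Rmult_lt_compat_l (s ^ 3 / PI ^ 2) _ _ K) in C.
replace (s ^ 3 / PI ^ 2 * (zeta_even (2 + p) t * (PI ^ 3 * c / s ^ 3)))
  with (PI * c * zeta_even (2 + p) t) in C by (field; lra).
replace (s ^ 3 / PI ^ 2 * (zeta_odd (3 + p) t * (PI ^ 2 / s ^ 2)))
  with (s * zeta_odd (3 + p) t) in C by (field; lra).
assert (0 < INR (2 + p) / PI ^ (2 + p) * s ^ (2 + p - 1)).
{ apply Rmult_lt_0_compat; [apply Rdiv_lt_0_compat|]; try now apply pow_lt.
  apply lt_0_INR; lia. }
nra.
Qed.

(** At 1/2 both the cosine and [zeta_odd] vanish, so only the derivative of the last factor
    contributes; the 2 comes from [zeta_even n (1 / 2) = 2 * zeta_nat n (1 / 2)]. *)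
Lemma is_derive_dh_infty_half (p : nat) :
  is_derive (dh_infty (2 + p)) (1 / 2)
    (2 * INR (2 + p) / PI ^ (2 + p)
     * (INR (3 + p) * zeta_nat (4 + p) (1 / 2)
        - PI ^ 2 * zeta_nat (2 + p) (1 / 2))).
Proof.
assert (h01 : 0 < 1 / 2 < 1) by lra.
assert (D0 := is_derive_zeta_even p _ h01).
assert (D1 := is_derive_zeta_odd (S p) _ h01).
assert (D : is_derive (fun u => PI * cos (PI * u) * zeta_even (2 + p) u
                                - sin (PI * u) * zeta_odd (3 + p) u) (1 / 2)
   (2 * (INR (3 + p) * zeta_nat (4 + p) (1 / 2)
         - PI ^ 2 * zeta_nat (2 + p) (1 / 2)))).
{ change (2 + S p)%nat with (3 + p)%nat in D1.
  change (3 + S p)%nat with (4 + p)%nat in D1.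
  set (f := zeta_even (2 + p)) in *; set (g := zeta_odd (3 + p)) in *.
  auto_derive.
  - split; [|split; [|easy]]; eexists; [exact D0|exact D1].
  - change (fun x => f x) with f; change (fun x => g x) with g.
    rewrite (is_derive_unique _ _ _ D0), (is_derive_unique _ _ _ D1).
    replace (PI * (1 / 2)) with (PI / 2) by field.
    rewrite sin_PI2, cos_PI2; unfold f, zeta_even.
    replace (1 - 1 / 2) with (1 / 2) by field; ring. }
assert (D' := is_derive_sin_pow_mult
  (INR (2 + p) / PI ^ (2 + p)) (2 + p - 1) _ _ _ D).
match type of D' with is_derive _ _ ?l =>
  replace (_ / _ * _) with l; [exact D'|] end.
replace (PI * (1 / 2)) with (PI / 2) by field.
rewrite sin_PI2, cos_PI2, !pow1; unfold zeta_odd.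
replace (1 - 1 / 2) with (1 / 2) by field.
field; apply pow_nonzero, PI_neq0.
Qed.

Theorem proposition4p5 :
  forall q : nat, (4 <= q)%nat -> Nat.Even q ->
    (forall t : R, 0 < t < 1 -> ex_derive (h_infty q) t) /\
    ex_derive_n (h_infty q) 2 (1 / 2) /\
    Derive_n (h_infty q) 2 (1 / 2) > 0 /\
    (forall t : R, 0 < t < 1 / 2 -> Derive (h_infty q) t < 0).
Proof.
intros q q4 _.
(* [q - 2] is the exponent left once the weights [y ^ 2] are split off. *)
replace q with (2 + (q - 2))%nat by lia.
set (p := (q - 2)%nat).
assert (p2 : (2 <= p)%nat) by (unfold p; lia).
assert (Dh : forall t, 0 < t < 1 -> Derive (h_infty (2 + p)) t = dh_infty (2 + p) t)
  by (intros t t01; now apply is_derive_unique, is_derive_h_infty).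
assert (D2 := is_derive_dh_infty_half p).
(* [Derive (h_infty (2 + p))] agrees with [dh_infty] only on (0,1), which suffices near 1/2. *)
apply (is_derive_ext_loc _ (Derive (h_infty (2 + p)))) in D2;
  [|apply locally_01; [lra|]; intros u u01; symmetry; now apply Dh].
repeat split.
- intros t t01; eexists; now apply is_derive_h_infty.
- eexists; exact D2.
- simpl Derive_n; apply Rlt_gt; erewrite is_derive_unique by exact D2.
  assert (Z := zeta_half_ratio p p2).
  apply Rmult_lt_0_compat; [|lra].
  apply Rdiv_lt_0_compat; [|apply pow_lt, PI_RGT_0].
  apply Rmult_lt_0_compat; [lra|apply lt_0_INR; lia].
- intros t t0; rewrite Dh by lra; apply dh_infty_neg; [lia|easy].
Qed.
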